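(* Let $n\ge 1$ and let $B\le \mathrm{poly}(n)$ be an a priori upper bound on the multiplicity of every edge in the final graph. There is an online scheme for \textsc{Triangles} on graph streams in the strict turnstile model over $n$ vertices (with multiplicities bounded by $B$) whose help cost and space cost are both $O(n\log n)$ bits, and whose error is at most $1/3$.
   Context: Strict turnstile graph streams: a stream is a sequence $\langle (e_1,\Delta_1),\dots,(e_m,\Delta_m)\rangle$ with each $e_i=\{u_i,v_i\}$ an undirected pair of vertices from $[n]$ and $\Delta_i\in\mathbb Z$; update $i$ adds $\Delta_i$ to the multiplicity of edge $e_i$. The final graph $G$ has edge multiplicities $M(u,v)=\sum_{i: e_i=\{u,v\}}\Delta_i$, which are assumed nonnegative at the end of the stream (intermediate multiplicities may be negative) and at most $B$. \textsc{Triangles}: output $\sum_{\{u,v,z\}} M(u,v)M(v,z)M(z,u)$, the sum over unordered triples of distinct vertices. Annotated data streams: for a function $F$ of a stream $\mathbf x=(x_1,\dots,x_m)\in\mathcal U^m$, a scheme is a pair $(\mathfrak h,V)$ where $\mathfrak h=(\mathfrak h_1,\dots,\mathfrak h_m)$, $\mathfrak h_i:\mathcal U^m\to\{0,1\}^*$ (the prover's annotation inserted after $x_i$), and $V$ is a single-pass streaming algorithm with a private random string $r$ reading the annotated stream $(x_1,\mathfrak h_1(\mathbf x),\dots,x_m,\mathfrak h_m(\mathbf x))$ and outputting a value or $\bot$. The scheme is online if each $\mathfrak h_i$ depends only on $x_1,\dots,x_i$. Completeness: for all $\mathbf x$, $\Pr_r[V \text{ outputs } \ne F(\mathbf x)]\le\delta_c$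 on the honest annotation. Soundness: for all $\mathbf x$ and every annotation $\mathfrak h'$, $\Pr_r[V\text{ outputs a value}\notin\{F(\mathbf x),\bot\}]\le\delta_s$. The error is $\max(\delta_s,\delta_c)$ (required $\le 1/3$). Help cost: $\max_{\mathbf x}\sum_i|\mathfrak h_i(\mathbf x)|$; space cost: bits of working memory used by $V$. *)

(* Defs.v *)
From HB Require Import structures.
From mathcomp Require Import all_boot all_order all_algebra.
Set Implicit Arguments. Unset Strict Implicit. Unset Printing Implicit Defensive.
Import Order.TTheory GRing.Theory Num.Theory.

(* An undirected pair {u,v} of distinct vertices, represented canonically as
   the ordered pair (u,v) with u < v. *)
Definition Edge (n : nat) := {p : 'I_n * 'I_n | p.1 < p.2}.

Definition Update (n : nat) := (Edge n * int)%type.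

Definition mult (n : nat) (x : seq (Update n)) (u v : 'I_n) : int :=
  (\sum_(t <- x | (val t.1 == (u, v)) || (val t.1 == (v, u))) t.2)%R.

Definition valid_stream (n B : nat) (x : seq (Update n)) : Prop :=
  forall u v : 'I_n, u < v -> (0 <= mult x u v)%R /\ (mult x u v <= B%:Z)%R.

Definition triangles (n : nat) (x : seq (Update n)) : int :=
  (\sum_(u : 'I_n) \sum_(v : 'I_n) \sum_(z : 'I_n | ((u < v)%N && (v < z)%N))
     mult x u v * mult x v z * mult x z u)%R.

(* Symbols of the annotated stream: a data item, or one bit of annotation
   (annotation strings are read bit by bit by the streaming verifier). *)
Inductive sym (U : Type) := Item of U | Bit of bool.

(* (x_1, h_1, ..., x_m, h_m); missing annotation strings are empty. *)
Fixpoint annotate (U : Type) (x : seq U) (hs : seq (seq bool)) : seq (sym U) :=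
  match x with
  | [::] => [::]
  | a :: x' => Item a :: map (@Bit U) (head [::] hs) ++ annotate x' (behead hs)
  end.

Definition online_help (U : Type) (h : seq U -> seq bool) (x : seq U)
  : seq (seq bool) := [seq h (take i x) | i <- iota 1 (size x)].

(* A single-pass streaming verifier with space s bits: its memory is an
   s-bit string; the private random string r (of length vr) only determines
   the initial memory contents (so random bits that are used must be stored). *)
Record verifier (U : Type) := Verifier {
  vr : nat;
  vs : nat;
  vinit : vr.-tuple bool -> vs.-tuple bool;
  vstep : vs.-tuple bool -> sym U -> vs.-tuple bool;
  vout : vs.-tuple bool -> option int  (* None = reject (bottom) *)
}.

Definition run (U : Type) (V : verifier U) (r : (vr V).-tuple bool)
  (w : seq (sym U)) : option int :=
  @vout U V (foldl (@vstep U V) (@vinit U V r) w).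

Definition prob_le_third (k : nat) (bad : pred (k.-tuple bool)) : Prop :=
  3 * #|[set r : k.-tuple bool | bad r]| <= 2 ^ k.

Definition triangles_online_scheme (n B m : nat)
  (h : seq (Update n) -> seq bool) (V : verifier (Update n))
  (help space : nat) : Prop :=
  [/\ vs V <= space,
      (forall x, size x = m -> valid_stream B x ->
         sumn [seq size hi | hi <- online_help h x] <= help),
      (forall x, size x = m -> valid_stream B x ->
         @prob_le_third (vr V)
           (fun r => @run (Update n) V r (annotate x (online_help h x)) != Some (triangles x)))
    &
      (forall x, size x = m -> valid_stream B x ->
         forall hs : seq (seq bool),
         @prob_le_third (vr V)
           (fun r => (@run (Update n) V r (annotate x hs) != Some (triangles x))
                     && (@run (Update n) V r (annotate x hs) != None)))].

(* Main.v *)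
Require Import Defs.
From HB Require Import structures.
From mathcomp Require Import all_boot all_order all_algebra.
From mathcomp Require Import zify ring.
Set Implicit Arguments. Unset Strict Implicit. Unset Printing Implicit Defensive.
Import Order.TTheory GRing.Theory Num.Theory.

(** Let M_i be the multiplicities before the i-th update ({u_i,v_i}, D_i). That
    update changes the number of triangles by D_i * sum_z M_i(u_i,z) M_i(v_i,z),
    so the final count is sum_z g(z) where
      g(Z) = sum_i D_i A_i(u_i,Z) A_i(v_i,Z)
    and A_i(u,Z) is the polynomial of degree < n interpolating M_i(u,.) over a
    prime field F_p. At the end of the stream the prover sends the 2n
    coefficients of g. The verifier keeps A_i(u,r) for every vertex u and a
    secret random point r, hence also g(r), and accepts a claimed polynomial
    only if it agrees with g at r; a wrong one agrees at fewer than 2n points.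
    The count is recovered from its residue because p > (nB)^3, and a prime
    p of O(log n) bits exists because every prime power dividing the central
    binomial coefficient C(2N,N) >= 2^N is at most 2N. *)

(** * Primes of polynomial size *)

(** By Legendre's formula the exponent of [p] is the sum over k of floor(2n/p^k) - 2 floor(n/p^k);
    every term is at most 1, and it vanishes once p^k > 2n. *)
Lemma pfactor_central_bin_leq p n : prime p -> 0 < n ->
  p ^ logn p 'C(n.*2, n) <= n.*2.
Proof.
move=> pr_p n_gt0; have p_gt1 := prime_gt1 pr_p.
have n2_gt0 : 0 < n.*2 by rewrite double_gt0.
apply: leq_trans (trunc_logP p_gt1 n2_gt0); rewrite leq_exp2l //.
have len : n <= n.*2 by rewrite -addnn leq_addr.
have bin_gt : 0 < 'C(n.*2, n) by rewrite bin_gt0.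
have := congr1 (logn p) (bin_fact len).
have -> : n.*2 - n = n by rewrite -addnn addnK.
rewrite lognM // ?muln_gt0 ?fact_gt0 // lognM ?fact_gt0 // !logn_fact //.
set t := trunc_log p _ => def_log.
have tle : t < n.*2.+1.
  rewrite ltnS; apply: leq_trans (trunc_logP p_gt1 n2_gt0).
  exact/ltnW/ltn_expl.
have le_sum : \sum_(1 <= k < n.*2.+1) n.*2 %/ p ^ k <=
    \sum_(1 <= k < n.*2.+1) (n %/ p ^ k).*2 + \sum_(1 <= k < n.*2.+1) (k <= t).
  rewrite -big_split /= big_nat [leqRHS]big_nat; apply: leq_sum => k _.
  have pk : 0 < p ^ k by rewrite expn_gt0 prime_gt0.
  case: (leqP k t) => [_ | ltk].
    rewrite -ltnS ltn_divLR //; have := ltn_ceil n pk; nia.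
  rewrite divn_small //; apply: leq_trans (trunc_log_ltn _ p_gt1) _.
  by rewrite leq_exp2l.
have sum_t : \sum_(1 <= k < n.*2.+1) (k <= t) <= t.
  rewrite (big_cat_nat (n := t.+1)) //= [X in _ + X]big_nat [X in _ + X]big1
    => [|i /andP[lti _]]; last by rewrite leqNgt lti.
  rewrite addn0; apply: leq_trans (_ : \sum_(1 <= k < t.+1) 1 <= _).
    by apply: leq_sum => i _; case: (i <= t).
  by rewrite sum_nat_const_nat subn1 muln1.
(* Terms with k > n vanish because p^k > n, so both Legendre sums may run over the same range. *)
have sum_n : \sum_(1 <= k < n.*2.+1) n %/ p ^ k = \sum_(1 <= k < n.+1) n %/ p ^ k.
  rewrite (big_cat_nat (n := n.+1)) //= [X in _ + X]big_nat [X in _ + X]big1 ?addn0 //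
    => i /andP[lti _].
  rewrite divn_small //; apply: leq_trans lti _; exact/ltnW/ltn_expl.
move: le_sum; rewrite -(big_morph double doubleD (erefl 0.*2)) sum_n.
lia.
Qed.

Lemma central_bin_geq n : 2 ^ n <= 'C(n.*2, n).
Proof.
elim: n => [|n IHn]; first by rewrite bin0.
have e1 : n.+1 * 'C(n.*2.+2, n.+1) = n.*2.+2 * 'C(n.*2.+1, n).
  by rewrite mul_bin_diag.
have := mul_bin_left n.*2.+1 n; have := binS n.*2 n; rewrite doubleS expnS.
have : 'C(n.*2.+1, n) >= 'C(n.*2, n) by case: (n) => [|k]; rewrite ?bin0 // binS leq_addr.
nia.
Qed.

Lemma linear_expn_lt k : 0 < k -> 5 * k * 2 ^ k < 2 ^ (5 * k).-1.
Proof.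
elim: k => // -[|k] IHk _ //.
have -> : (5 * k.+2).-1 = 5 + (5 * k.+1).-1 by lia.
have := IHk isT; rewrite expnD [2 ^ k.+2]expnS; move: (2 ^ _) (2 ^ _) => a b.
rewrite (_ : 2 ^ 5 = 32) //; nia.
Qed.

(** Put N = 2^(5k-1). Without a prime in the range, C(2N,N) has at most 2^k prime divisors, each
    contributing a factor at most 2N = 2^(5k); hence 2^N <= 2^(5k 2^k), against [linear_expn_lt]. *)
Lemma exists_prime_expn k : 0 < k -> exists2 p, prime p & 2 ^ k < p <= 2 ^ (5 * k).
Proof.
move=> k_gt0; pose n := 2 ^ (5 * k).-1.
have n2 : n.*2 = 2 ^ (5 * k) by rewrite -mul2n -expnS prednK // muln_gt0.
have n_gt0 : 0 < n by rewrite expn_gt0.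
case: (boolP (has (fun p => prime p && (2 ^ k < p)) (iota 0 n.*2.+1))).
  case/hasP=> p; rewrite mem_iota ltnS /= => le_p /andP[pr_p lt_p].
  by exists p; rewrite // lt_p -n2.
move/hasPn => no_p; suff : 2 ^ n <= 2 ^ (5 * k * 2 ^ k).
  by rewrite leq_exp2l // leqNgt linear_expn_lt.
apply: leq_trans (central_bin_geq n) _; set b := 'C(_, _).
have b_gt0 : 0 < b by rewrite bin_gt0 -addnn leq_addr.
rewrite [b]prod_prime_decomp // prime_decompE big_map /=.
apply: leq_trans (_ : \prod_(p <- primes b) n.*2 <= _).
  rewrite big_seq [leqRHS]big_seq; apply: leq_prod => p.
  by rewrite mem_primes => /and3P[pr_p _ _]; apply: pfactor_central_bin_leq.
rewrite big_const_seq count_predT iter_muln_1 n2 -expnM leq_exp2l // leq_mul2l.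
apply/orP; right; rewrite -[leqRHS](size_iota 1).
apply: uniq_leq_size (primes_uniq b) _ => p p_b; rewrite mem_iota.
have /and3P[pr_p _ _] : [&& prime p, 0 < b & p %| b] by rewrite -mem_primes.
rewrite prime_gt0 //= add1n ltnS leqNgt; apply/negP => lt_p.
have : p <= n.*2.
  apply: leq_trans (pfactor_central_bin_leq pr_p n_gt0).
  by rewrite -{1}[p]expn1 leq_exp2l ?prime_gt1 // logn_gt0.
by move=> le_p; have := no_p p; rewrite mem_iota /= ltnS le_p pr_p lt_p => /(_ isT).
Qed.

(** * The sketch and the triangle count *)

Section Sketch.
Local Open Scope ring_scope.
Variable n : nat.

(* With L w the w-th interpolation polynomial, s.1 u is A_i(u,Z) and s.2 is the
   part of g(Z) due to the updates read so far; the verifier runs the same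
   recursion on the values at r. *)
Definition sketch_step (K : comNzRingType) (L : 'I_n -> K)
    (s : {ffun 'I_n -> K} * K) (t : Update n) : {ffun 'I_n -> K} * K :=
  let: (u, v) := val t.1 in
  ([ffun w => s.1 w + ((w == u)%:R * L v + (w == v)%:R * L u) * t.2%:~R],
   s.2 + s.1 u * s.1 v * t.2%:~R).

Definition sketch (K : comNzRingType) (L : 'I_n -> K) (x : seq (Update n)) :=
  foldl (sketch_step L) ([ffun=> 0], 0) x.

Lemma eq_sketch (K : comNzRingType) (L L' : 'I_n -> K) x :
  L =1 L' -> sketch L x = sketch L' x.
Proof.
move=> eqL; rewrite /sketch; move: (_, _) => s; elim: x s => //= t x IHx s.
rewrite IHx /sketch_step; case: (val t.1) => u v; rewrite !eqL.
by congr foldl; congr pair; apply/ffunP => w; rewrite !ffunE !eqL.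
Qed.

(** The recursion uses ring operations only. The two instances needed are evaluation of polynomials
    at a point and reduction of integers modulo p. *)
Lemma sketch_rmorph (K K' : comNzRingType) (f : {rmorphism K -> K'})
    (L : 'I_n -> K) x :
  sketch (f \o L) x = ([ffun w => f ((sketch L x).1 w)], f (sketch L x).2).
Proof.
elim/last_ind: x => [|x t IHx].
  by congr pair; rewrite ?rmorph0 //; apply/ffunP => w; rewrite !ffunE rmorph0.
rewrite /sketch -!cats1 !foldl_cat /= -!/(sketch _ _) IHx /sketch_step.
case: (val t.1) => u v /=; congr pair.
  by apply/ffunP => w; rewrite !ffunE /= rmorphD rmorphM rmorphD !rmorphM
    !rmorph_nat rmorph_int.
by rewrite !ffunE rmorphD !rmorphM rmorph_int.
Qed.

Lemma size_sketch (F : fieldType) d (L : 'I_n -> {poly F}) x :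
  (forall w, (size (L w) <= d)%N) ->
  (forall w, (size ((sketch L x).1 w) <= d)%N) /\
  (size (sketch L x).2 <= d.*2)%N.
Proof.
move=> szL; elim/last_ind: x => [|x t [IH1 IH2]].
  by split=> [w|]; rewrite /= ?ffunE size_poly0.
rewrite /sketch -!cats1 !foldl_cat /= -!/(sketch _ _) /sketch_step.
have szI (p : {poly F}) (z : int) e : (size p <= e)%N -> (size (p * z%:~R)%R <= e)%N.
  by move=> le_p; rewrite -(rmorph_int polyC) mulrC mul_polyC (leq_trans (size_scale_leq _ _)).
case: (val t.1) => u v /=; split=> [w|].
  rewrite ffunE (leq_trans (size_polyD _ _)) // geq_max IH1 /= szI //.
  rewrite (leq_trans (size_polyD _ _)) // geq_max.
  by apply/andP; split; case: eqP => _; rewrite ?mul1r ?mul0r ?size_poly0.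
rewrite (leq_trans (size_polyD _ _)) // geq_max IH2 /= szI //.
rewrite (leq_trans (size_polyMleq _ _)) // (leq_trans (leq_pred _)) // -addnn.
exact: leq_add.
Qed.

Lemma mult_sym (x : seq (Update n)) u v : mult x u v = mult x v u.
Proof. by apply: eq_bigl => t; rewrite orbC. Qed.

Lemma mult_diag (x : seq (Update n)) u : mult x u u = 0.
Proof.
rewrite /mult big1_seq // => -[[[a b] /= ltab] d] /andP[/= /orP ab _].
by case: ab => /eqP[ea eb]; move: ltab; rewrite /= ea eb ltnn.
Qed.

Lemma mult_rcons (x : seq (Update n)) t u v :
  mult (rcons x t) u v = mult x u v +
    (if (val t.1 == (u, v)) || (val t.1 == (v, u)) then t.2 else 0).
Proof. by rewrite /mult -cats1 big_cat big_cons big_nil /=; case: ifP; rewrite ?addr0. Qed.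

(** These values of [L] are those of the Lagrange polynomials at the node of [z], where
    interpolation is exact. *)
Lemma sketch_delta x z w :
  (sketch (fun w => (w == z)%:R : int) x).1 w = mult x w z.
Proof.
elim/last_ind: x => [|x t IHx]; first by rewrite /= ffunE /mult big_nil.
rewrite /sketch -!cats1 !foldl_cat /= -!/(sketch _ _) /sketch_step cats1.
rewrite mult_rcons -IHx; case: t => -[[u v] /= ltuv] d /=.
rewrite ffunE /= intz !xpair_eqE; congr (_ + _).
have : u != v by apply: contraTneq ltuv => ->; rewrite ltnn.
rewrite (eq_sym u w) (eq_sym v w).
case: (w =P u); case: (v =P z); case: (w =P v); case: (u =P z) => /=;
  try by move=> *; ring.
by move=> -> _ -> _; rewrite eqxx.
Qed.

(** Pads a sum over one vertex to a triple sum that can be compared termwise with [triangles]. *)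
Lemma sum_delta2 (a b : 'I_n) (c : int) :
  \sum_i \sum_j ((i == a)%:R * (j == b)%:R) * c = c.
Proof.
rewrite (bigD1 a) //= [X in _ + X]big1 => [|i /negPf->].
  rewrite (bigD1 b) //= big1 => [|j /negPf->]; first by rewrite !eqxx !addr0 !mul1r.
  by rewrite mulr0 mul0r.
by rewrite big1 // => j _; rewrite !mul0r.
Qed.

(** Since [triangles] lists vertices in increasing order, the third vertex of a triangle on the
    updated edge a < b is treated separately above b, below a and between them; z = a and z = b
    contribute 0. *)
Lemma triangles_rcons (x : seq (Update n)) t :
  triangles (rcons x t) = triangles x +
    (\sum_z mult x (val t.1).1 z * mult x (val t.1).2 z) * t.2.
Proof.
case: t => -[[a b] /= ltab] d /=; pose f z := mult x a z * mult x b z * d.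
rewrite mulr_suml (eq_bigr (fun z : 'I_n =>
  (b < z)%N%:R * f z + (z < a)%N%:R * f z + (a < z < b)%N%:R * f z)); last first.
  move=> z _; rewrite -!mulrDl -/(f z) -!natrD.
  case: (altP (z =P a)) => [->|za]; first by rewrite /f mult_diag !mul0r mulr0.
  case: (altP (z =P b)) => [->|zb]; first by rewrite /f mult_diag mulr0 !mul0r mulr0.
  rewrite (_ : (_ + _)%N = 1%N) ?mul1r //.
  by move: za zb; rewrite -!val_eqE /=; lia.
rewrite !big_split /=.
have -> : \sum_(z < n) (b < z)%N%:R * f z =
    \sum_(u < n) \sum_(v < n) \sum_(z < n) ((u == a)%:R * (v == b)%:R) * ((b < z)%N%:R * f z).
  under [RHS]eq_bigr do rewrite exchange_big; rewrite exchange_big.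
  by under [RHS]eq_bigr do rewrite sum_delta2.
have -> : \sum_(u < n) (u < a)%N%:R * f u =
    \sum_(u < n) \sum_(v < n) \sum_(z < n) ((v == a)%:R * (z == b)%:R) * ((u < a)%N%:R * f u).
  by under [RHS]eq_bigr do rewrite sum_delta2.
have -> : \sum_(v < n) (a < v < b)%N%:R * f v =
    \sum_(u < n) \sum_(v < n) \sum_(z < n) ((u == a)%:R * (z == b)%:R) * ((a < v < b)%N%:R * f v).
  by rewrite exchange_big; under [RHS]eq_bigr do rewrite sum_delta2.
rewrite /triangles -!big_split; apply: eq_bigr => u _.
rewrite -!big_split; apply: eq_bigr => v _.
rewrite big_mkcond [in RHS]big_mkcond /= -!big_split; apply: eq_bigr => z _ /=.
have eqE (i j k l : 'I_n) : ((i, j) == (k, l)) = ((i == k :> nat) && (j == l :> nat)).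
  by rewrite xpair_eqE -!val_eqE.
rewrite !mulrA -!natrM !mulnb -!val_eqE /=.
case: ifP => [/andP[ltuv ltvz] | nlt]; last first.
  rewrite add0r; do 3![rewrite [X in (nat_of_bool X)%:R](_ : _ = false) ?mul0r; last lia].
  by rewrite !addr0.
(* Within u < v < z the edge (a,b) can only be (u,v), (v,z) or (u,z); each choice matches one of the
   three padded sums. *)
rewrite !mult_rcons /= !eqE.
rewrite (_ : (_ && _ && (b < z)%N) = ((a == u :> nat) && (b == v :> nat))); last by lia.
rewrite (_ : (_ && _ && (u < a)%N) = ((a == v :> nat) && (b == z :> nat))); last by lia.
rewrite (_ : (_ && _ && (a < v < b)%N) = ((a == u :> nat) && (b == z :> nat))); last by lia.
rewrite (_ : (a == v :> nat) && (b == u :> nat) = false) ?orbF; last by lia.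
rewrite (_ : (a == z :> nat) && (b == v :> nat) = false) ?orbF; last by lia.
rewrite (_ : (a == z :> nat) && (b == u :> nat) = false) /=; last by lia.
rewrite {}/f.
case: (boolP ((a == u :> nat) && (b == v :> nat))) => [/andP[/eqP au /eqP bv] | _].
  have -> : (a == v :> nat) = false by lia.
  have -> : (b == z :> nat) = false by lia.
  rewrite -(val_inj au) -(val_inj bv) (mult_sym x z a) !andbF /=; ring.
case: (boolP ((a == v :> nat) && (b == z :> nat))) => [/andP[/eqP av /eqP bz] | _].
  have -> : (a == u :> nat) = false by lia.
  rewrite -(val_inj av) -(val_inj bz) (mult_sym x u a) (mult_sym x a b) /=; ring.
case: (boolP ((a == u :> nat) && (b == z :> nat))) => [/andP[/eqP au /eqP bz] | _].
  rewrite -(val_inj au) -(val_inj bz) (mult_sym x v b) /=; ring.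
by rewrite /= !addr0 !mul0r !addr0.
Qed.

Lemma triangles_sketch x :
  triangles x = \sum_z (sketch (fun w => (w == z)%:R : int) x).2.
Proof.
elim/last_ind: x => [|x t IHx].
  rewrite /triangles big1 => [|u _]; first by rewrite big1.
  by rewrite big1 // => v _; rewrite big1 // => z _; rewrite /mult !big_nil !mul0r.
rewrite triangles_rcons IHx mulr_suml -big_split; apply: eq_bigr => z _.
rewrite /sketch -!cats1 !foldl_cat /= -!/(sketch _ _) /sketch_step /=.
by case: (val t.1) => u v; rewrite !sketch_delta intz.
Qed.

Lemma triangles_bound B (x : seq (Update n)) : valid_stream B x ->
  0 <= triangles x <= ((n * B) ^ 3)%N%:Z.
Proof.
move=> valx.
(* Validity speaks of u < v only; symmetry and the zero diagonal extend it to all pairs. *)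
have valx2 u v : 0 <= mult x u v <= B%:Z.
  case: (ltngtP u v) => [ltuv | ltvu | /val_inj->]; last by rewrite mult_diag.
    by apply/andP; apply: valx.
  by rewrite mult_sym; apply/andP; apply: valx.
have val3 u v z : 0 <= mult x u v * mult x v z * mult x z u <= (B ^ 3)%N%:Z.
  have /andP[h1 h2] := valx2 u v; have /andP[h3 h4] := valx2 v z.
  have /andP[h5 h6] := valx2 z u.
  rewrite !mulr_ge0 //= (_ : (B ^ 3)%N%:Z = B%:Z * B%:Z * B%:Z).
    by rewrite !ler_pM // mulr_ge0.
  by rewrite !expnS expn0 muln1 !PoszM mulrA.
apply/andP; split.
  apply: sumr_ge0 => u _; apply: sumr_ge0 => v _; apply: sumr_ge0 => z _.
  by case/andP: (val3 u v z).
have -> : ((n * B) ^ 3)%N%:Z = \sum_(u < n) \sum_(v < n) \sum_(z < n) (B ^ 3)%N%:Z.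
  rewrite !sumr_const !card_ord -(natz ((n * B) ^ 3)) -(natz (B ^ 3)) -!mulrnA.
  by congr (_ *+ _); rewrite expnMn mulnC -mulnA !expnS expn0 muln1 !mulnA.
apply: ler_sum => u _; apply: ler_sum => v _; rewrite big_mkcond.
by apply: ler_sum => z _; case: ifP => // _; case/andP: (val3 u v z).
Qed.

End Sketch.

(** * Finite encodings and interpolation *)

Lemma exists_injective (T T' : finType) :
  #|T| <= #|T'| -> exists f : T -> T', injective f.
Proof.
move=> leT; exists (fun t => enum_val (widen_ord leT (enum_rank t))) => t t'.
move/enum_val_inj/(congr1 val) => eq_rank.
exact/enum_rank_inj/val_inj.
Qed.

Lemma exists_bit_encoding (T : finType) s :
  #|T| <= 2 ^ s -> exists f : T -> s.-tuple bool, injective f.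
Proof. by move=> leT; apply: exists_injective; rewrite card_tuple card_bool. Qed.

Lemma exists_lagrange (F : fieldType) n (pt : 'I_n -> F) : injective pt ->
  exists L : 'I_n -> {poly F}, (forall w, size (L w) <= n) /\
    forall w z, (L w).[pt z]%R = ((w == z)%:R)%R.
Proof.
move=> pt_inj; pose P w := (\prod_(j < n | j != w) ('X - (pt j)%:P))%R.
exists (fun w => (P w).[pt w]^-1 *: P w)%R; split=> [w | w z].
  rewrite (leq_trans (size_scale_leq _ _)) // /P -big_filter size_prod_XsubC.
  rewrite size_filter -sum1_count sum1_card.
  by case: n w {pt pt_inj P} => [[]//|n] w; rewrite cardC1 card_ord.
rewrite hornerZ; have [<- | neq_wz] := eqVneq w z.
  rewrite mulVf // horner_prod; apply/prodf_neq0 => j neq_jw.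
  by rewrite hornerXsubC subr_eq0 inj_eq // eq_sym.
rewrite [X in (_ * X)%R]horner_prod (bigD1 z) 1?eq_sym //=.
by rewrite hornerXsubC subrr mul0r mulr0.
Qed.

(** * Verifiers given by finite automata *)

Section Automaton.
Variables (U : Type) (T : finType) (k s : nat) (enc : T -> s.-tuple bool).
Variables (init : k.-tuple bool -> T) (step : T -> sym U -> T).
Variable out : T -> option int.

(** The default branches handle bit strings outside the image of [enc], which no run reaches. *)
Definition automaton_verifier : verifier U :=
  @Verifier U k s (enc \o init)
    (fun y a => if [pick t | enc t == y] is Some t then enc (step t a) else y)
    (fun y => if [pick t | enc t == y] is Some t then out t else None).

Lemma run_automaton r w : injective enc ->
  @run U automaton_verifier r w = out (foldl step (init r) w).
Proof.
move=> enc_inj; have encK t : [pick t' | enc t' == enc t] = Some t.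
  by case: pickP => [t' /eqP/enc_inj-> // | /(_ t)]; rewrite eqxx.
rewrite /run /=; move: (init r) => t; elim: w t => [|a w IHw] t /=.
  by rewrite encK.
by rewrite encK IHw.
Qed.

End Automaton.

(** * Layout of the annotated stream *)

Section Annotation.
Variable U : Type.

(** A state that reacts to updates only is immune to any annotation, honest or not; this is applied
    to the sketch. *)
Lemma foldl_annotate (S : Type) (f : S -> U -> S) s x hs :
  foldl (fun s a => if a is Item t then f s t else s) s (annotate x hs)
  = foldl f s x.
Proof.
elim: x hs s => //= t x IHx hs s; rewrite foldl_cat IHx.
by congr foldl; elim: (head _ _) => //= b bs ->.
Qed.

Lemma annotate_last_help (x : seq U) b : 0 < size x ->
  annotate x (rcons (nseq (size x).-1 [::]) b) =
  map (@Item U) x ++ map (@Bit U) b.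
Proof.
case: x => // t x _; elim: x t => [|t' x IHx] t /=; first by rewrite cats0.
by congr cons; apply: IHx.
Qed.

(** Only the full prefix has size [m], so all help arrives after the last update, when an online
    prover knows the whole stream. *)
Lemma online_help_last (c : seq U -> seq bool) m x : size x = m -> 0 < m ->
  online_help (fun y => if size y == m then c y else [::]) x =
  rcons (nseq m.-1 [::]) (c x).
Proof.
case: m => // m szx _; rewrite /online_help szx.
rewrite (_ : iota 1 m.+1 = iota 1 m ++ [:: m.+1]) ?map_cat; last by rewrite -{1}(addn1 m) iotaD.
rewrite /= take_oversize szx // eqxx cats1; congr rcons.
apply: (@eq_from_nth _ [::]) => [|i]; rewrite size_map size_iota ?size_nseq // => lti.
rewrite (nth_map 0) ?size_iota // nth_iota // nth_nseq lti size_take szx.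
by case: ltnP; case: eqP => //; lia.
Qed.

(* The bits received so far; None records a violated format, that is, a data
   item after the first bit or more than l bits. *)
Definition buffer_step l (c : option (l.-bseq bool)) (a : sym U) :=
  match c, a with
  | Some b, Item _ => if nilp b then c else None
  | Some b, Bit y => insub (rcons b y)
  | None, _ => None
  end.

Lemma buffer_honest l (x : seq U) (b : l.-tuple bool) :
  foldl (@buffer_step l) (Some [bseq]) (map (@Item U) x ++ map (@Bit U) b)
  = Some (bseq_of_tuple b).
Proof.
rewrite foldl_cat; have -> : foldl (@buffer_step l) (Some [bseq]) (map (@Item U) x) = Some [bseq].
  by elim: x.
(* Generalised over the bits [c] already stored; being a prefix of [e], they never overflow the
   buffer. *)
have H (c : l.-bseq bool) (d : seq bool) (e : l.-bseq bool) : e = c ++ d :> seq bool ->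
    foldl (@buffer_step l) (Some c) (map (@Bit U) d) = Some e.
  elim: d c => [|y d IHd] c /= => [|ecd].
    by rewrite cats0 => ec; congr Some; apply/val_inj.
  have szc : size (rcons c y) <= l.
    by have := size_bseq e; rewrite ecd size_cat size_rcons /=; lia.
  by rewrite (insubT (fun s => size s <= l) szc); apply: IHd; rewrite /= cat_rcons.
exact: H.
Qed.

End Annotation.

(** * The scheme *)

(** There are 2^(l+1) - 1 strings of length at most l, and [None] completes the power of two: the
    buffer costs l + 1 bits. *)
Lemma card_option_bseq l : #|{: option (l.-bseq bool)}| = 2 ^ l.+1.
Proof.
rewrite card_option card_bseq card_bool; have := predn_exp 2 l.+1.
by rewrite mul1n => <-; rewrite prednK // expn_gt0.
Qed.

Lemma card_roots_leq (T : finType) (F : fieldType) (f : T -> F) (P : {poly F}) d :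
  injective f -> P != 0%R -> size P <= d -> #|[set t | root P (f t)]| <= d.
Proof.
move=> f_inj P_neq0 szP; rewrite cardE -(size_map f); apply: leq_trans szP.
apply/ltnW/max_poly_roots => //.
  by apply/allP => _ /mapP[t + ->]; rewrite mem_enum inE.
by rewrite map_inj_uniq ?enum_uniq.
Qed.

Lemma Fp_intr_val p (t : int) : prime p -> (0 <= t)%R -> (t < p%:Z)%R ->
  Posz (val (t%:~R : 'F_p)%R) = t.
Proof.
move=> pr_p; case: t => // t _; rewrite ltz_nat => lt_tp.
by rewrite /= -pmulrn val_Fp_nat // modn_small.
Qed.

Section Scheme.
Variables (n p k l : nat).
Variables (pt : 'I_n -> 'F_p) (rnd : k.-tuple bool -> 'F_p).
Variables (lag : 'I_n -> {poly 'F_p}) (code : 'rV['F_p]_(n.*2) -> l.-tuple bool).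

(** The secret point, the sketch values at that point, and the annotation buffer. *)
Definition scheme_state : Type :=
  ('F_p * ({ffun 'I_n -> 'F_p} * 'F_p) * option (l.-bseq bool))%type.

Definition scheme_init (r : k.-tuple bool) : scheme_state :=
  (rnd r, ([ffun=> 0%R], 0%R), Some [bseq]).

Definition scheme_step (s : scheme_state) (a : sym (Update n)) : scheme_state :=
  (s.1.1,
   if a is Item t then sketch_step (fun w => (lag w).[s.1.1]%R) s.1.2 t
   else s.1.2,
   buffer_step s.2 a).

(** A buffer with fewer than [l] bits equals no code word, so incomplete annotations are rejected
    too. *)
Definition scheme_out (s : scheme_state) : option int :=
  if s.2 is Some b then
    if [pick v | code v == b :> seq bool] is Some v then
      if ((rVpoly v).[s.1.1] == s.1.2.2)%R
      then Some (Posz (val (\sum_z (rVpoly v).[pt z])%R)) else None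
    else None
  else None.

Definition transcript_poly (x : seq (Update n)) : {poly 'F_p} := (sketch lag x).2.

Definition final_help x : l.-tuple bool := code (poly_rV (transcript_poly x)).

Definition prover_help (m : nat) (x : seq (Update n)) : seq bool :=
  if size x == m then final_help x : seq bool else [::].

Lemma scheme_foldl r x hs :
  foldl scheme_step (scheme_init r) (annotate x hs) =
  (rnd r, sketch (fun w => (lag w).[rnd r]%R) x,
   foldl (@buffer_step _ l) (Some [bseq]) (annotate x hs)).
Proof.
rewrite /sketch -(foldl_annotate (sketch_step _) _ x hs) /scheme_init.
move: (annotate _ _) ([ffun=> _], _) (Some _) => w s c.
by elim: w s c => //= a w IHw s c; rewrite -IHw.
Qed.

Lemma sketch_horner y x :
  (sketch (fun w => (lag w).[y]%R) x).2 = (transcript_poly x).[y]%R.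
Proof. by have /(congr1 snd) := sketch_rmorph (horner_eval y) lag x. Qed.

Hypothesis pr_p : prime p.
Hypotheses (rnd_inj : injective rnd) (code_inj : injective code).
Hypothesis size_lag : forall w, size (lag w) <= n.
Hypothesis lagE : forall w z, (lag w).[pt z]%R = ((w == z)%:R)%R.

(** At the node [pt z] the transcript is the image modulo p of the integer sketch of
    [triangles_sketch], by [lagE]. *)
Lemma sum_transcript x :
  (\sum_z (transcript_poly x).[pt z] = (triangles x)%:~R :> 'F_p)%R.
Proof.
rewrite triangles_sketch rmorph_sum; apply: eq_bigr => z _.
rewrite -sketch_horner /=.
have -> := eq_sketch x (lagE^~ z).
have /(congr1 snd) /= <- := sketch_rmorph (intr : {rmorphism int -> 'F_p})
  (fun w => (w == z)%:R)%R x.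
by congr snd; apply: eq_sketch => w /=; rewrite rmorph_nat.
Qed.

Lemma size_transcript x : size (transcript_poly x) <= n.*2.
Proof. by have [] := size_sketch x size_lag. Qed.

Lemma val_sum_transcript B x : valid_stream B x -> (n * B) ^ 3 < p ->
  Posz (val (\sum_z (transcript_poly x).[pt z])%R) = triangles x.
Proof.
move=> /triangles_bound/andP[t_ge0 t_le] lt_p.
by rewrite sum_transcript Fp_intr_val // (le_lt_trans t_le).
Qed.

Lemma pick_code v : [pick v' | code v' == code v :> seq bool] = Some v.
Proof.
case: pickP => [v' /eqP/val_inj/code_inj-> // | /(_ v)].
by rewrite eqxx.
Qed.

Lemma scheme_complete B m x r : size x = m -> 0 < m -> valid_stream B x ->
  (n * B) ^ 3 < p ->
  scheme_out (foldl scheme_step (scheme_init r) (annotate x (online_help (prover_help m) x)))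
  = Some (triangles x).
Proof.
move=> szx m_gt0 valx lt_p.
rewrite scheme_foldl (online_help_last final_help szx m_gt0) -szx annotate_last_help ?szx //.
rewrite buffer_honest /scheme_out /= pick_code poly_rV_K ?size_transcript //.
by rewrite sketch_horner eqxx (val_sum_transcript valx lt_p).
Qed.

(* The buffer does not depend on the random point, so neither does the
   polynomial that is compared with the transcript at that point. *)
Lemma scheme_sound B x hs : valid_stream B x -> (n * B) ^ 3 < p ->
  #|[set r | let o := scheme_out (foldl scheme_step (scheme_init r) (annotate x hs)) in
       (o != Some (triangles x)) && (o != None)]| <= n.*2.
Proof.
move=> valx lt_p; under eq_finset => r do rewrite scheme_foldl.
case: (foldl _ _ _) => [b|]; last by rewrite /scheme_out /= eq_card0 // => r; rewrite inE.
rewrite /scheme_out /=; case: pickP => [v _ | _]; last first.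
  by rewrite eq_card0 // => r; rewrite inE.
have [eq_v | neq_v] := eqVneq (rVpoly v) (transcript_poly x).
  rewrite eq_card0 // => r; rewrite inE sketch_horner eq_v eqxx.
  by rewrite (val_sum_transcript valx lt_p) eqxx.
(* A bad random string yields a root of this nonzero difference, whose size is at most 2n. *)
apply: leq_trans (card_roots_leq rnd_inj (_ : rVpoly v - transcript_poly x != 0)%R _).
- apply/subset_leq_card/subsetP => r; rewrite !inE sketch_horner.
  case: ifP => [/eqP eq_r _|]; last by rewrite andbF.
  by rewrite /root hornerD hornerN eq_r subrr.
- by rewrite subr_eq0.
rewrite (leq_trans (size_polyD _ _)) // size_polyN geq_max size_transcript.
by rewrite size_poly.
Qed.

End Scheme.

(** A field element takes [q] bits: the help is 2n of them, the memory n + 2 of them and the buffer.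
    With [k] random bits the soundness error is at most 2n/2^k. *)
Lemma exists_triangles_scheme n B m p k q : 0 < m -> prime p ->
  (n * B) ^ 3 < p -> n <= p -> 2 ^ k <= p -> 3 * n.*2 <= 2 ^ k -> p <= 2 ^ q ->
  exists (h : seq (Update n) -> seq bool) (V : verifier (Update n)),
    @triangles_online_scheme n B m h V
      (q * n.*2) (q * n.+2 + (q * n.*2).+1).
Proof.
move=> m_gt0 pr_p lt_p le_np le_kp le_nk le_pq; set l := q * n.*2.
have cardF : #|'F_p| = p by apply: card_Fp.
have [pt pt_inj] : exists pt : 'I_n -> 'F_p, injective pt.
  by apply: exists_injective; rewrite card_ord cardF.
have [rnd rnd_inj] : exists rnd : k.-tuple bool -> 'F_p, injective rnd.
  by apply: exists_injective; rewrite card_tuple card_bool cardF.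
have [lag [size_lag lagE]] := exists_lagrange pt_inj.
have [code code_inj] : exists code : 'rV['F_p]_(n.*2) -> l.-tuple bool, injective code.
  apply: exists_bit_encoding; rewrite card_mx [#|_|]cardF mul1n /l expnM.
  by have [->|] := posnP n.*2; rewrite ?expn0 // => n2; rewrite leq_exp2r.
have [enc enc_inj] : exists enc : scheme_state n p l -> (q * n.+2 + l.+1).-tuple bool,
    injective enc.
  apply: exists_bit_encoding; rewrite !card_prod card_option_bseq card_ffun cardF card_ord.
  by rewrite expnD leq_mul2r -expnSr -expnS expnM leq_exp2r // le_pq orbT.
exists (prover_help lag code m), (automaton_verifier enc (scheme_init n l rnd)
  (scheme_step lag) (scheme_out pt code)).
split=> [//|x szx valx|x szx valx|x szx valx hs].
- rewrite (online_help_last (final_help lag code) szx m_gt0) map_rcons map_nseq sumn_rcons.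
  by rewrite sumn_nseq mul0n size_tuple.
- rewrite /prob_le_third eq_card0 ?muln0 // => r; rewrite inE run_automaton //.
  by rewrite (scheme_complete rnd pr_p code_inj size_lag lagE _ szx m_gt0 valx lt_p) eqxx.
rewrite /prob_le_third; apply: leq_trans le_nk; apply: leq_mul => //.
apply: leq_trans (scheme_sound code pr_p rnd_inj size_lag lagE hs valx lt_p).
by apply/subset_leq_card/subsetP => r; rewrite !inE run_automaton.
Qed.

Theorem theorem3p1 :
  forall c : nat, exists C : nat,
  forall n B m : nat, 1 <= n -> B <= n ^ c ->
  exists (h : seq (Update n) -> seq bool) (V : verifier (Update n)),
    @triangles_online_scheme n B m h V
      (C * (n * (trunc_log 2 n).+1)) (C * (n * (trunc_log 2 n).+1)).
Proof.
(* Of the factor 3c + 6, the bound on (nB)^3 takes 3c + 3 and the rest leaves room for e + 3 <= k.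
   With q = 5k the space is 5k(n+2) + 10kn + 1 <= 30kn. *)
move=> c; exists (30 * (3 * c + 6)) => n B m n_gt0 leB.
set e := (trunc_log 2 n).+1; pose k := (3 * c + 6) * e.
have [-> | m_gt0] := posnP m.
  (* An empty stream offers no place for help, but its count is 0. *)
  exists (fun=> [::]), (@Verifier (Update n) 0 0 id (fun s _ => s) (fun=> Some 0%R)).
  have tri0 (x : seq (Update n)) : size x = 0 -> triangles x = 0%R.
    by move/size0nil->; rewrite triangles_sketch big1.
  split=> [//|x /size0nil-> //|x szx _|x szx _ hs].
    by rewrite /prob_le_third eq_card0 // => r; rewrite inE /run /= tri0.
  by rewrite /prob_le_third eq_card0 // => r; rewrite inE /run /= tri0.
have lt_ne : n < 2 ^ e by apply: trunc_log_ltn.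
have [|p pr_p /andP[lt_kp le_p]] := @exists_prime_expn k; first by rewrite muln_gt0 addn_gt0 orbT.
have bound_B : (n * B) ^ 3 <= 2 ^ k.
  have : n * B <= n ^ c.+1 by rewrite expnS leq_mul2l leB orbT.
  rewrite -(leq_exp2r _ _ (isT : 0 < 3)) => /leq_trans; apply.
  rewrite -expnM; apply: leq_trans (_ : (2 ^ e) ^ (c.+1 * 3) <= _).
    by rewrite leq_exp2r ?muln_gt0 // ltnW.
  by rewrite -expnM leq_exp2l // mulnC /k leq_mul2r; apply/orP; right; lia.
have le_e : e + 3 <= k by rewrite /k /e; nia.
(* With e + 3 random bits there are 8 * 2^e >= 6n points, which gives error at most 1/3. *)
have [] := @exists_triangles_scheme n B m p (e + 3) (5 * k) m_gt0 pr_p.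
- exact: leq_ltn_trans lt_kp.
- apply: leq_trans (ltnW lt_ne) _; apply: leq_trans (ltnW lt_kp).
  by rewrite leq_exp2l //; lia.
- by apply: leq_trans (ltnW lt_kp); rewrite leq_exp2l.
- by rewrite expnD; lia.
- exact: le_p.
move=> h [V [spV helpV complV soundV]]; exists h, V.
have C_E : 30 * (3 * c + 6) * (n * e) = 30 * k * n by rewrite /k; lia.
have k_gt0 : 0 < k by rewrite /k; nia.
rewrite C_E; split=> // [|x szx valx].
  by apply: leq_trans spV _; nia.
by apply: leq_trans (helpV x szx valx) _; nia.
Qed.
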